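(* For every partition $\mu$, every $n\ge 0$ and every partition $\lambda\vdash n$, $$\widehat P_\mu^{[n]}\times_{q,t}Q_\lambda = P_\mu^*(\lambda)\,Q_\lambda .$$ More generally, for every $f\in\mathrm{Sym}$, every $n\ge0$ and every $\lambda\vdash n$, $$\widehat f^{[n]}\times_{q,t}Q_\lambda=f^*(\lambda)\,Q_\lambda ,$$ and $f\mapsto\widehat f$ is the unique linear map from $\mathrm{Sym}$ to the degree completion of $\mathrm{Sym}$ with this property.
   Context: $\mathrm{Sym}$ is the ring of symmetric functions over $\mathbb Q(q,t)$ in an alphabet $X$; its degree completion consists of the formal infinite sums $F=\sum_{n\ge0}F^{[n]}$ with $F^{[n]}$ homogeneous of degree $n$. Macdonald functions. $\langle\cdot,\cdot\rangle_{q,t}$ is the Macdonald scalar product $\langle p_\lambda,p_\mu\rangle_{q,t}=\delta_{\lambda\mu}z_\lambda\prod_i\frac{1-q^{\lambda_i}}{1-t^{\lambda_i}}$. $P_\lambda=P_\lambda(X;q,t)$ are the monic Macdonald functions, $Q_\lambda$ the dual basis of $P_\lambda$ for $\langle\cdot,\cdot\rangle_{q,t}$, and $J_\lambda=c_\lambda P_\lambda$ the integral forms, where $c_\lambda=c_\lambda(q,t)=\prod_{s\in\lambda}(1-q^{a(s)}t^{l(s)+1})$ and $c'_\lambda=c'_\lambda(q,t)=\prod_{s\in\lambda}(1-q^{a(s)+1}t^{l(s)})$, with $a(s),l(s)$ the arm and leg lengths of $s$. One has $\langle J_\lambda,J_\lambda\rangle_{q,t}=j_\lambda=c_\lambda c'_\lambda$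 and $Q_\lambda=J_\lambda/c'_\lambda$. Product. In homogeneous degree $n$, let $\Gamma^{(n)}_{q,t}J_\lambda=\frac1{n!}J_\lambda\otimes J_\lambda$ for $\lambda\vdash n$ (extended linearly), and let $\times_{q,t}$ be the product on degree-$n$ symmetric functions dual to it: $\langle F\times_{q,t}G,H\rangle_{q,t}=\langle F\otimes G,\Gamma^{(n)}_{q,t}H\rangle_{q,t}$. Equivalently $J_\lambda\times_{q,t}J_\mu=\delta_{\lambda\mu}\frac{j_\lambda}{n!}J_\lambda$ for $\lambda,\mu\vdash n$. Shifted Macdonald polynomials (Okounkov's normalization). Put $n(\lambda)=\sum_i(i-1)\lambda_i$ and let $\lambda'$ be the conjugate of $\lambda$. $P_\mu^*(x;q,t)$ is the interpolation polynomial characterized as follows: for every $N\ge\ell(\mu)$ it is a polynomial in $x_1,\dots,x_N$ of degree at most $|\mu|$, symmetric in the variables $x_it^{1-i}$, compatible with setting the last variable equal to $1$, with $P_\mu^*(q^\lambda;q,t)=0$ for all $\lambda\ne\mu$ with $|\lambda|\le|\mu|$, $\ell(\lambda)\le N$, and $P_\mu^*(q^\mu;q,t)=(-1)^{|\mu|}q^{n(\mu')}t^{-2n(\mu)}c'_\mu(q,t)$; here $q^\lambda=(q^{\lambda_1},q^{\lambda_2},\dots)$. Its top homogeneous component is $P_\mu(x_1,x_2t^{-1},x_3t^{-2},\dots;q,t)$, and $P_\mu^*(q^\lambda;q,t)=0$ unless $\mu\subseteq\lambda$. Write $P_\mu^*(\lambda):=P_\mu^*(q^\lambda;q,t)$.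 For $f=\sum_\mu f_\mu P_\mu\in\mathrm{Sym}$ put $f^*=\sum_\mu f_\mu P_\mu^*$ and $f^*(\lambda)=\sum_\mu f_\mu P_\mu^*(\lambda)$. Hat transform. For every $n\ge0$ let $\widehat P_\mu^{[n]}:=n!\sum_{\lambda\vdash n}\frac{P_\mu^*(\lambda)}{c_\lambda(q,t)}Q_\lambda$, let $\widehat P_\mu=\sum_{n\ge|\mu|}\widehat P_\mu^{[n]}$ in the degree completion, and extend $P_\mu\mapsto\widehat P_\mu$ linearly to $f\mapsto\widehat f$; $\widehat f^{[n]}$ is the degree-$n$ component of $\widehat f$. *)

(* Defs.v *)
From HB Require Import structures.
From mathcomp Require Import all_boot all_order all_fingroup all_algebra.
From mathcomp Require Import boolp classical_sets functions cardinality fsbigop.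
From mathcomp Require Import finmap mpoly.
From mathcomp.multinomials Require Import (canonicals) monalg.

Set Implicit Arguments.
Unset Strict Implicit.
Unset Printing Implicit Defensive.

Import GRing.Theory.
Local Open Scope ring_scope.

Definition K : fieldType := {fraction {mpoly rat[2]}}.
Definition q : K := @FracField.tofrac {mpoly rat[2]} 'X_0.
Definition t : K := @FracField.tofrac {mpoly rat[2]} 'X_1.

Definition is_part (s : seq nat) : bool := sorted geq s && (0%N \notin s).

Record intpart : Type := IntPart {parts :> seq nat; partsP : is_part parts}.
HB.instance Definition _ := [isSub for parts].
HB.instance Definition _ := [Countable of intpart by <:].

Definition psize (la : intpart) : nat := sumn la.

Lemma finite_parts n : finite_set [set la : intpart | psize la = n]%classic.
Proof.
pose e : intpart := @IntPart [::] isT.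
pose f (b : n.-bseq 'I_n.+1) : intpart := insubd e [seq val i | i <- b].
apply: (@sub_finite_set _ _ (f @` [set: n.-bseq 'I_n.+1])%classic); last first.
  exact/finite_image/finite_finset.
move=> [s sP] /=; rewrite {1}/psize /= => nE; subst n.
have size_s : (size s <= sumn s)%N.
  case/andP: sP => _; elim: s {f} => //= x s IHs; rewrite inE negb_or eq_sym -lt0n.
  by case/andP=> x0 /IHs le_s; rewrite -add1n; apply: leq_add.
have le_s x : x \in s -> (x < (sumn s).+1)%N.
  elim: s {f sP size_s} => //= y s IHs; rewrite inE ltnS => /predU1P[->|/IHs].
    exact: leq_addr.
  by rewrite ltnS => le_x; apply: leq_trans le_x (leq_addl _ _).
have size_b : (size [seq inord x : 'I_(sumn s).+1 | x <- s] <= sumn s)%N.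
  by rewrite size_map.
exists (Bseq size_b) => //; apply: val_inj; rewrite /f val_insubd /=.
have -> : [seq val i | i <- [seq inord x : 'I_(sumn s).+1 | x <- s]] = s.
  rewrite -map_comp -[RHS]map_id; apply/eq_in_map => x /le_s lt_x /=.
  exact: inordK.
by rewrite sP.
Qed.

Definition conj_seq (s : seq nat) : seq nat :=
  [seq count (fun x => j < x)%N s | j <- iota 0 (head 0%N s)].

(* n(la) = \sum_i (i - 1) la_i, with rows indexed from 0 here *)
Definition nstat (s : seq nat) : nat :=
  (\sum_(i < size s) i * nth 0 s i)%N.

(* arm and leg lengths of the box in row i and column j, indexed from 0 *)
Definition arm (s : seq nat) (i j : nat) : nat := (nth 0 s i - j.+1)%N.
Definition leg (s : seq nat) (i j : nat) : nat :=
  (nth 0 (conj_seq s) j - i.+1)%N.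

Definition c_ (la : intpart) : K :=
  \prod_(i < size la) \prod_(j < nth 0%N la i)
    (1 - q ^+ arm la i j * t ^+ (leg la i j).+1).
Definition c'_ (la : intpart) : K :=
  \prod_(i < size la) \prod_(j < nth 0%N la i)
    (1 - q ^+ (arm la i j).+1 * t ^+ leg la i j).

Definition z_ (la : intpart) : nat :=
  (\prod_(k <- undup la) (k ^ count_mem k la * (count_mem k la)`!))%N.

Definition dom_lt (mu la : intpart) : Prop :=
  [/\ mu <> la, psize mu = psize la
    & forall k, (sumn (take k mu) <= sumn (take k la))%N].

Section FiniteVariables.
Variable R : idomainType.
Implicit Types N : nat.

(* sets the last variable equal to c *)
Definition set_last N (c : R) (p : {mpoly R[N.+1]}) : {mpoly R[N]} :=
  p \mPo [tuple oapp (fun j => 'X_j) c%:MP (unlift ord_max i) | i < N.+1].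

Definition psum_poly N (k : nat) : {mpoly R[N]} := \sum_(i < N) 'X_i ^+ k.

(* the sum of the distinct monomials x^a with a a permutation of s, padded
   with zeros; it vanishes when N < size s *)
Definition mono_poly N (s : seq nat) : {mpoly R[N]} :=
  \sum_(m : 'X_{1..N < (sumn s).+1} | perm_eq [seq x <- m | x != 0%N] s) 'X_[m].

Lemma set_lastX N c (i : 'I_N.+1) :
  set_last c 'X_i = oapp (fun j => 'X_j) c%:MP (unlift ord_max i).
Proof. by rewrite /set_last comp_mpolyXU -tnth_nth tnth_mktuple. Qed.

Lemma set_last_psum N k : set_last 0 (psum_poly N.+1 k.+1) = psum_poly N k.+1.
Proof.
rewrite /set_last /psum_poly big_ord_recr /= rmorphD rmorph_sum !rmorphXn /=.
rewrite -!/(set_last _ _) set_lastX unlift_none /= mpolyC0 expr0n addr0.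
apply: eq_bigr => i _; rewrite rmorphXn /= -/(set_last _ _) set_lastX.
have -> : widen_ord (leqnSn N) i = lift ord_max i.
  by apply/val_inj; rewrite /= /bump leqNgt ltn_ord.
by rewrite liftK.
Qed.

Lemma psum_sym N k : psum_poly N k \is symmetric.
Proof.
apply/issymP => s; rewrite /psum_poly raddf_sum /=.
rewrite [RHS](reindex_inj (@perm_inj _ s)) /=.
apply: eq_bigr => i _; rewrite rmorphXn /=; congr (_ ^+ _).
rewrite msymX; congr 'X_[_]; apply/mnmP => j.
by rewrite !mnmE -(inj_eq (@perm_inj _ s)) permKV.
Qed.

Lemma msize_psum N k : (msize (psum_poly N k) <= k.+1)%N.
Proof.
apply: leq_trans (msize_sum _ _ _) _.
apply/bigmax_leqP_seq => i _ _.
by rewrite mpolyXn msizeX mdegMn mdeg1 mul1n.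
Qed.

Lemma psum_homog N k : psum_poly N k \is [in R[N], k.-homog].
Proof.
apply: rpred_sum => i _.
by rewrite mpolyXn dhomogX /= mdegMn mdeg1 mul1n.
Qed.

Lemma mcoeff_mono N s (m : 'X_{1..N}) :
  (mono_poly N s)@_m = (perm_eq [seq x <- m | x != 0%N] s)%:R.
Proof.
rewrite /mono_poly raddf_sum /=.
under eq_bigr do rewrite mcoeffX.
case: (ltnP (mdeg m) (sumn s).+1) => [lt_m|ge_m].
  rewrite big_mkcond /= (bigD1 (BMultinom lt_m)) //= eqxx big1 ?addr0.
    by case: ifP.
  move=> m' ne_m'; case: ifP => // _; case: eqP => // e.
  by move: ne_m'; rewrite -(inj_eq val_inj) /= e eqxx.
rewrite big1.
  case: (boolP (perm_eq _ _)) => // /perm_sumn e.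
  have /eqP : sumn [seq x <- m | x != 0%N] = mdeg m.
    rewrite !sumnE mdegE big_filter /= big_tuple [RHS](bigID (fun i => m i != 0%N)) /=.
    rewrite [X in (_ + X)%N]big1 ?addn0 => [|i /negPn /eqP //].
    by apply: eq_big => [i|i _]; rewrite mnm_tnth.
  by rewrite e => /eqP e'; move: ge_m; rewrite -e' ltnn.
move=> m' _; case: eqP => // e; move: (bmdeg m'); rewrite e.
by rewrite ltnNge ge_m.
Qed.

Definition mext N (m : 'X_{1..N}) : 'X_{1..N.+1} :=
  [multinom oapp m 0%N (unlift ord_max i) | i < N.+1].

Lemma mcoeff_set_last0 N (p : {mpoly R[N.+1]}) m :
  (set_last 0 p)@_m = p@_(mext m).
Proof.
rewrite /set_last comp_mpolyEX raddf_sum /=.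
rewrite [p in RHS]mpolyE raddf_sum /=; apply: eq_bigr => k _.
rewrite !mcoeffZ; congr (_ * _).
rewrite comp_mpolyX big_ord_recr /= tnth_mktuple unlift_none /= mpolyC0.
have -> : \prod_(i < N)
   tnth [tuple oapp (fun j => 'X_j) 0 (unlift ord_max i) | i < N.+1]
       (widen_ord (leqnSn N) i) ^+ k (widen_ord (leqnSn N) i)
  = 'X_[R, [multinom k (widen_ord (leqnSn N) i) | i < N]].
  rewrite mpolyXE_id; apply: eq_bigr => i _; rewrite tnth_mktuple mnmE.
  have -> : widen_ord (leqnSn N) i = lift ord_max i.
    by apply/val_inj; rewrite /= /bump leqNgt ltn_ord.
  by rewrite liftK.
rewrite !mcoeffX expr0n.
have [k0|k0] := eqVneq (k ord_max) 0%N; last first.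
  rewrite mulr0 mcoeff0; case: eqP => // e; move: k0.
  by rewrite e mnmE unlift_none eqxx.
rewrite mulr1 mcoeffX; congr (nat_of_bool _)%:R.
apply/eqP/eqP => [<-|->]; apply/mnmP => i; rewrite !mnmE.
  case: unliftP => [j ->|->] //=; rewrite mnmE; congr (k _).
  by apply/val_inj; rewrite /= /bump leqNgt ltn_ord.
have -> : widen_ord (leqnSn N) i = lift ord_max i.
  by apply/val_inj; rewrite /= /bump leqNgt ltn_ord.
by rewrite liftK.
Qed.

Lemma set_last_mono N s : set_last 0 (mono_poly N.+1 s) = mono_poly N s.
Proof.
apply/mpolyP => m; rewrite mcoeff_set_last0 !mcoeff_mono.
congr (nat_of_bool (perm_eq _ _))%:R.
have -> : mext m = rcons m 0%N :> seq nat.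
  apply: (@eq_from_nth _ 0%N) => [|i]; rewrite ?size_rcons ?size_tuple //.
  move=> lt_i; rewrite -[i]/(nat_of_ord (Ordinal lt_i)) -mnm_nth mnmE nth_rcons.
  rewrite size_tuple; case: unliftP => [j ->|->] /=.
    have -> : bump N j = j by rewrite /bump leqNgt (ltn_ord j).
    by rewrite (ltn_ord j) -mnm_nth.
  by rewrite ltnn eqxx.
by rewrite filter_rcons.
Qed.

Lemma mono_sym N s : mono_poly N s \is symmetric.
Proof.
apply/issymP => u; apply/mpolyP => m; rewrite mcoeff_sym !mcoeff_mono.
suff /(perm_filter (fun x => x != 0%N)) /permPl -> :
  perm_eq [multinom m (u i) | i < N] m by [].
by apply/tuple_permP; exists u.
Qed.

Lemma msize_mono N s : (msize (mono_poly N s) <= (sumn s).+1)%N.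
Proof.
apply: leq_trans (msize_sum _ _ _) _.
by apply/bigmax_leqP_seq => i _ _; rewrite msizeX; apply: bmdeg.
Qed.
End FiniteVariables.

Definition polyfam : Type := forall N : nat, {mpoly K[N]}.

HB.instance Definition _ := gen_eqMixin polyfam.
HB.instance Definition _ := gen_choiceMixin polyfam.

Section PolyFam.
Implicit Types f g h : polyfam.

Let pf_ext f g : (forall N, f N = g N) -> f = g.
Proof. exact: functional_extensionality_dep. Qed.

Definition pf_zero : polyfam := fun=> 0.
Definition pf_opp f : polyfam := fun N => - f N.
Definition pf_add f g : polyfam := fun N => f N + g N.
Definition pf_one : polyfam := fun=> 1.
Definition pf_mul f g : polyfam := fun N => f N * g N.
Definition pf_scale (a : K) f : polyfam := fun N => a *: f N.

Fact pf_addA : associative pf_add.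
Proof. by move=> f g h; apply: pf_ext => N; apply: addrA. Qed.
Fact pf_addC : commutative pf_add.
Proof. by move=> f g; apply: pf_ext => N; apply: addrC. Qed.
Fact pf_add0 : left_id pf_zero pf_add.
Proof. by move=> f; apply: pf_ext => N; apply: add0r. Qed.
Fact pf_addN : left_inverse pf_zero pf_opp pf_add.
Proof. by move=> f; apply: pf_ext => N; apply: addNr. Qed.

HB.instance Definition _ :=
  GRing.isZmodule.Build polyfam pf_addA pf_addC pf_add0 pf_addN.

Fact pf_mulA : associative pf_mul.
Proof. by move=> f g h; apply: pf_ext => N; apply: mulrA. Qed.
Fact pf_mulC : commutative pf_mul.
Proof. by move=> f g; apply: pf_ext => N; apply: mulrC. Qed.
Fact pf_mul1 : left_id pf_one pf_mul.
Proof. by move=> f; apply: pf_ext => N; apply: mul1r. Qed.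
Fact pf_mulDl : left_distributive pf_mul +%R.
Proof. by move=> f g h; apply: pf_ext => N; apply: mulrDl. Qed.
Fact pf_one_neq0 : pf_one != 0.
Proof.
apply/eqP => /(congr1 (fun f : polyfam => f 0%N)) /eqP.
by rewrite (oner_eq0 {mpoly K[0]}).
Qed.

HB.instance Definition _ := GRing.Zmodule_isComNzRing.Build polyfam
  pf_mulA pf_mulC pf_mul1 pf_mulDl pf_one_neq0.

Fact pf_scaleA a b f : pf_scale a (pf_scale b f) = pf_scale (a * b) f.
Proof. by apply: pf_ext => N; apply: scalerA. Qed.
Fact pf_scale1 : left_id 1 pf_scale.
Proof. by move=> f; apply: pf_ext => N; apply: scale1r. Qed.
Fact pf_scaleDr : right_distributive pf_scale +%R.
Proof. by move=> a f g; apply: pf_ext => N; apply: scalerDr. Qed.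
Fact pf_scaleDl f : {morph pf_scale^~ f : a b / a + b}.
Proof. by move=> a b; apply: pf_ext => N; apply: scalerDl. Qed.

HB.instance Definition _ := GRing.Zmodule_isLmodule.Build K polyfam
  pf_scaleA pf_scale1 pf_scaleDr pf_scaleDl.

Fact pf_scaleAl a f g : a *: (f * g) = (a *: f) * g.
Proof. by apply: pf_ext => N; apply: scalerAl. Qed.

HB.instance Definition _ := GRing.Lmodule_isLalgebra.Build K polyfam pf_scaleAl.
HB.instance Definition _ := GRing.Lalgebra_isComAlgebra.Build K polyfam.

End PolyFam.

(* Sym is the inverse limit, in the category of graded rings, of the rings of
   symmetric polynomials in N variables along x_{N+1} |-> 0: a symmetric
   function is given by its images in all finite numbers of variables. *)
Definition is_symfun (f : polyfam) : Prop :=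
  [/\ forall N, f N \is symmetric,
      forall N, set_last 0 (f N.+1) = f N
    & exists d, forall N, (msize (f N) <= d)%N].

Definition symfun_pred : {pred polyfam} := fun f => `[< is_symfun f >].

Fact symfun_subalg_closed : GRing.subalg_closed symfun_pred.
Proof.
split.
- apply/asboolP; split=> [N|N|]; first exact: rpred1.
  + exact: rmorph1.
  + by exists 1%N => N; rewrite msize1.
- move=> a f g /asboolP[sf cf [df bf]] /asboolP[sg cg [dg bg]].
  apply/asboolP; split=> [N|N|].
  + by apply/issymP => s; rewrite msymD msymZ (issymP _ (sf N)) (issymP _ (sg N)).
  + by rewrite /set_last linearP; congr (a *: _ + _); [apply: cf | apply: cg].
  + exists (maxn df dg) => N; apply: leq_trans (msizeD_le _ _) _.
    rewrite geq_max !leq_max bg orbT andbT.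
    by rewrite (leq_trans (msizeZ_le _ _)).
- move=> f g /asboolP[sf cf [df bf]] /asboolP[sg cg [dg bg]].
  apply/asboolP; split=> [N|N|].
  + by apply/issymP => s; rewrite msymM (issymP _ (sf N)) (issymP _ (sg N)).
  + by rewrite /set_last rmorphM; congr (_ * _); [apply: cf | apply: cg].
  + exists (df + dg)%N => N; have -> : (f * g) N = f N * g N by [].
    have [->|nf] := eqVneq (f N) 0; first by rewrite mul0r msize0.
    have [->|ng] := eqVneq (g N) 0; first by rewrite mulr0 msize0.
    rewrite (@msizeM N K) //; apply: leq_trans (leq_pred _) _.
    exact: leq_add.
Qed.

HB.instance Definition _ :=
  GRing.isSubalgClosed.Build K polyfam symfun_pred
    (GRing.subalg_closed_semi symfun_subalg_closed).

Record SymFun : Type := MkSymFun {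
  symfam :> polyfam;
  symfamP : symfam \in symfun_pred
}.
HB.instance Definition _ := [isSub for symfam].
HB.instance Definition _ := [Choice of SymFun by <:].
HB.instance Definition _ := [SubChoice_isSubComNzRing of SymFun by <:].
HB.instance Definition _ := [SubZmodule_isSubLmodule of SymFun by <:].
HB.instance Definition _ := [SubNzRing_SubLmodule_isSubLalgebra of SymFun by <:].
HB.instance Definition _ := [SubLalgebra_isSubAlgebra of SymFun by <:].

Definition homdeg (n : nat) : {pred SymFun} :=
  fun f => `[< forall N, symfam f N \is [in K[N], n.-homog] >].

Fact homdeg_submod_closed n : GRing.submod_closed (homdeg n).
Proof.
split=> [|a f g /asboolP hf /asboolP hg]; apply/asboolP => N.
  exact: dhomog0.
by apply: dhomogD; [apply: dhomogZ|].
Qed.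

HB.instance Definition _ n :=
  GRing.isSubmodClosed.Build K SymFun (homdeg n)
    (GRing.submod_closed_semi (homdeg_submod_closed n)).

(* The completion of Sym: sequences of homogeneous components. *)
Definition compl_pred : {pred nat -> SymFun} :=
  fun F => `[< forall n, F n \in homdeg n >].

Fact compl_submod_closed : GRing.submod_closed compl_pred.
Proof.
split=> [|a F G /asboolP hF /asboolP hG]; apply/asboolP => n.
  exact: rpred0.
by apply: rpredD; [apply: rpredZ|].
Qed.

HB.instance Definition _ :=
  GRing.isSubmodClosed.Build K (nat -> SymFun) compl_pred
    (GRing.submod_closed_semi compl_submod_closed).

Record Compl : Type := MkCompl {
  component :> nat -> SymFun;
  componentP : component \in compl_pred
}.
HB.instance Definition _ := [isSub for component].
HB.instance Definition _ := [Choice of Compl by <:].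
HB.instance Definition _ := [SubChoice_isSubLmodule of Compl by <:].

Fact psum_subproof k : (fun N => psum_poly K N k.+1) \in symfun_pred.
Proof.
apply/asboolP; split=> [N|N|]; first exact: psum_sym.
  exact: set_last_psum.
by exists k.+2 => N; apply: msize_psum.
Qed.

(* The index is shifted, psum k = p_{k+1}: p_0 is not stable in N. *)
Definition psum (k : nat) : SymFun := MkSymFun (psum_subproof k).

Definition p_ (la : intpart) : SymFun := \prod_(k <- la) psum k.-1.

Fact mono_subproof (la : intpart) : (fun N => mono_poly K N la) \in symfun_pred.
Proof.
apply/asboolP; split=> [N|N|]; first exact: mono_sym.
  exact: set_last_mono.
by exists (sumn la).+1 => N; apply: msize_mono.
Qed.

Definition m_ (la : intpart) : SymFun := MkSymFun (mono_subproof la).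

(* Used only when B is a basis of Sym: then the set below is a singleton. *)
Definition coord (B : intpart -> SymFun) (f : SymFun) : monalg.malg intpart K :=
  xget 0 [set a : monalg.malg intpart K |
    f = \sum_(la <- monalg.msupp a) monalg.mcoeff la a *: B la]%classic.

(* the linear map sending B la to g la for every la *)
Definition linext (V : lmodType K) (B : intpart -> SymFun) (g : intpart -> V)
    (f : SymFun) : V :=
  \sum_(la <- monalg.msupp (coord B f)) monalg.mcoeff la (coord B f) *: g la.

Definition weight (la : intpart) : K :=
  (z_ la)%:R * \prod_(k <- la) ((1 - q ^+ k) / (1 - t ^+ k)).

Definition form (F G : SymFun) : K :=
  \sum_(la <- monalg.msupp (coord p_ F))
     monalg.mcoeff la (coord p_ F) * monalg.mcoeff la (coord p_ G) * weight la.

(* Sym (x) Sym, in coordinates on its basis p_ la (x) p_ mu *)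
Definition SymTens : lmodType K := monalg.malg (intpart * intpart)%type K.

Definition tens (F G : SymFun) : SymTens :=
  \sum_(la <- monalg.msupp (coord p_ F))
    \sum_(mu <- monalg.msupp (coord p_ G))
      monalg.mkmalgU (la, mu)
        (monalg.mcoeff la (coord p_ F) * monalg.mcoeff mu (coord p_ G)).

(* <F (x) G, F' (x) G'> = <F, F'> <G, G'> *)
Definition form2 (S T : SymTens) : K :=
  \sum_(k <- monalg.msupp S)
     monalg.mcoeff k S * monalg.mcoeff k T * (weight k.1 * weight k.2).

(* P_la is monic and unitriangular on the m_mu for the dominance order, and the
   P_la are pairwise orthogonal; these conditions determine the family P. *)
Definition is_macdonald (P : intpart -> SymFun) : Prop :=
  (forall la, exists u : intpart -> K,
     P la = m_ la + \sum_(mu \in [set mu | dom_lt mu la]%classic) u mu *: m_ mu)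
  /\ (forall la mu, la <> mu -> form (P la) (P mu) = 0).

Section Macdonald.
Variable P : intpart -> SymFun.

Definition J_ (la : intpart) : SymFun := c_ la *: P la.

(* The pairing is graded and nondegenerate, so the element dual to P mu lives in
   degree |mu|. *)
Definition Q_ (mu : intpart) : SymFun :=
  xget 0 [set g : SymFun | g \in homdeg (psize mu) /\
            forall la, form (P la) g = (la == mu)%:R]%classic.

(* Gamma n is applied in degree n only; Sym^n is spanned by the J_la with
   |la| = n. *)
Definition Gamma (n : nat) : SymFun -> SymTens :=
  linext J_ (fun la => (n`!%:R)^-1 *: tens (J_ la) (J_ la)).

(* The product dual to Gamma n for the scalar product; nondegeneracy on Sym^n
   makes R unique. *)
Definition qtprod (n : nat) (F G : SymFun) : SymFun :=
  xget 0 [set R : SymFun | R \in homdeg n /\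
            forall H, H \in homdeg n ->
              form R H = form2 (tens F G) (Gamma n H)]%classic.

End Macdonald.

Fact Q_homog P mu : Q_ P mu \in homdeg (psize mu).
Proof. by rewrite /Q_; case: xgetP => [g _ []//|_]; apply: rpred0. Qed.

(* the point (q^{la_1}, ..., q^{la_N}) *)
Definition qpow (N : nat) (la : intpart) : 'I_N -> K :=
  fun i => q ^+ nth 0%N la i.

(* symmetry in the variables y_i = x_i t^{1-i}: substitute x_i = t^{i-1} y_i *)
Definition shifted_symmetric (N : nat) (p : {mpoly K[N]}) : Prop :=
  p \mPo [tuple t ^+ i *: 'X_i | i < N] \is symmetric.

(* Ps mu N is P*_mu in N variables; only N >= l(mu) is constrained. *)
Definition is_shifted_macdonald (Ps : intpart -> forall N, {mpoly K[N]}) : Prop :=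
  forall (mu : intpart) (N : nat), (size mu <= N)%N ->
  [/\ (msize (Ps mu N) <= (psize mu).+1)%N,
      shifted_symmetric (Ps mu N),
      set_last 1 (Ps mu N.+1) = Ps mu N,
      forall la : intpart, la <> mu -> (psize la <= psize mu)%N ->
        (size la <= N)%N -> (Ps mu N).@[qpow la] = 0
    & (Ps mu N).@[qpow mu] =
        (-1) ^+ psize mu * q ^+ nstat (conj_seq mu) / t ^+ (2 * nstat mu) * c'_ mu].

Section Hat.
Variables (P : intpart -> SymFun) (Ps : intpart -> forall N, {mpoly K[N]}).

(* P*_mu(la): by stability, any N >= max(l(mu), l(la)) gives the same value *)
Definition Pstar_at (mu la : intpart) : K :=
  (Ps mu (maxn (size mu) (size la))).@[qpow la].

(* f*(la), where f = \sum_mu f_mu P_mu and f* = \sum_mu f_mu P*_mu *)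
Definition star_at (f : SymFun) (la : intpart) : K :=
  linext P (fun mu => Pstar_at mu la : K^o) f.

Definition hatP_comp (mu : intpart) (n : nat) : SymFun :=
  n`!%:R *: \sum_(la \in [set la | psize la = n]%classic)
               (Pstar_at mu la / c_ la) *: Q_ P la.

Fact hatP_subproof mu :
  (fun n => if (psize mu <= n)%N then hatP_comp mu n else 0) \in compl_pred.
Proof.
apply/asboolP => n; case: ifP => _; last exact: rpred0.
rewrite /hatP_comp fsbig_finite; last exact: finite_parts.
apply: rpredZ; rewrite big_seq; apply: rpred_sum => la.
rewrite in_fset_set; last exact: finite_parts.
move=> /set_mem /= <-; apply: rpredZ; apply: Q_homog.
Qed.

Definition hatP (mu : intpart) : Compl := MkCompl (hatP_subproof mu).

Definition hat : SymFun -> Compl := linext P hatP.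

End Hat.

(* Main.v *)
Require Import Defs.
From HB Require Import structures.
From mathcomp Require Import all_boot all_order all_fingroup all_algebra.
From mathcomp Require Import boolp classical_sets functions cardinality fsbigop.
From mathcomp Require Import finmap mpoly.
From mathcomp.multinomials Require Import (canonicals) monalg.
Import Defs.

(* The family P is orthogonal, so Q_la = P_la / <P_la, P_la> and
   <Q_la, J_mu> = c_la if la = mu and 0 otherwise. Pairing with the basis J of
   degree n, on which Gamma is (1 / n!) J (x) J, gives, for any F and any la of
   size n,
     F x_{q,t} Q_la = (<F, J_la> / n!) Q_la,
   so the statement amounts to <hat f^{[n]}, J_la> = n! f*(la), which is read off
   the definition of hat f. Conversely these pairings determine an element of
   degree n, whence uniqueness. Of the interpolation polynomials only the
   vanishing P*_mu(la) = 0 for |la| < |mu| matters.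
   That p and P are bases of Sym follows from triangularity on the monomial
   functions: p for the number of parts, P for a numerical rank that is strictly
   increasing for the dominance order. *)

Set Implicit Arguments.
Unset Strict Implicit.
Unset Printing Implicit Defensive.

Import GRing.Theory.
Local Open Scope ring_scope.

(** * Finite linear combinations and spans *)

Section LinearCombinations.
Variables (F : fieldType) (I : choiceType) (V : lmodType F).
Implicit Types (g : I -> V) (a b : monalg.malg I F) (S : I -> Prop).

(** The sum inside [linext], seen as a function of the coefficients: [linext B g f] is convertible
    to [lincomb g (coord B f)], so it inherits linearity from this map. *)
Definition lincomb g a : V :=
  \sum_(k <- monalg.msupp a) monalg.mcoeff k a *: g k.

Lemma lincombEw g a (D : {fset I}) : (monalg.msupp a `<=` D)%fset ->
  lincomb g a = \sum_(k <- D) monalg.mcoeff k a *: g k.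
Proof.
move=> sub; apply: big_fset_incl => // k _ /monalg.mcoeff_outdom ->.
by rewrite scale0r.
Qed.

Fact lincomb_linear g : linear (lincomb g).
Proof.
move=> c a b; pose D := (monalg.msupp a `|` monalg.msupp b)%fset.
have subZ : (monalg.msupp (c *: a) `<=` monalg.msupp a)%fset.
  exact: monalg.msuppZ_le.
rewrite !(@lincombEw _ _ D) ?fsubsetUl ?fsubsetUr //; last first.
  by apply: fsubset_trans (monalg.msuppD_le _ _) _; apply: fsetSU.
rewrite scaler_sumr -big_split /=; apply: eq_bigr => k _.
by rewrite monalg.mcoeffD monalg.mcoeffZ scalerDl scalerA.
Qed.

HB.instance Definition _ g :=
  GRing.isLinear.Build F (monalg.malg I F) V _ (lincomb g) (lincomb_linear g).

Lemma lincombU g c k : lincomb g (monalg.mkmalgU k c) = c *: g k.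
Proof.
rewrite (@lincombEw _ _ [fset k]%fset) ?monalg.msuppU_le //.
by rewrite big_seq_fset1 monalg.mcoeffUU.
Qed.

(** The predicate [S] on indices keeps track of degrees: it is used with the partitions of a fixed
    size. *)
Definition spanned S g (v : V) : Prop :=
  exists2 a, (forall k, monalg.mcoeff k a != 0 -> S k) & v = lincomb g a.

Lemma spannedP S g c u v :
  spanned S g u -> spanned S g v -> spanned S g (c *: u + v).
Proof.
move=> [a Sa ->] [b Sb ->]; exists (c *: a + b); last by rewrite linearP.
move=> k; rewrite monalg.mcoeffD monalg.mcoeffZ.
have [/Sa //|/negPn/eqP ->] := boolP (monalg.mcoeff k a != 0).
by rewrite mulr0 add0r => /Sb.
Qed.

Lemma spanned0 S g : spanned S g 0.
Proof.
by exists 0; [move=> k; rewrite monalg.mcoeff0 eqxx | rewrite linear0].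
Qed.

Lemma spannedZ S g c u : spanned S g u -> spanned S g (c *: u).
Proof. by move=> Su; rewrite -[c *: u]addr0; apply/spannedP/spanned0. Qed.

Lemma spanned_sum S g (T : eqType) (r : seq T) (Q : pred T) (f : T -> V) :
  (forall x, x \in r -> Q x -> spanned S g (f x)) ->
  spanned S g (\sum_(x <- r | Q x) f x).
Proof.
move=> Sf; rewrite big_seq_cond; elim/big_ind: _ => [|u v Su Sv|x /andP[xr Qx]].
- exact: spanned0.
- by rewrite -[u]scale1r; apply: spannedP.
- exact: Sf.
Qed.

Lemma spanned_gen S g k : S k -> spanned S g (g k).
Proof.
move=> Sk; exists (monalg.mkmalgU k 1); last by rewrite lincombU scale1r.
move=> l; rewrite monalg.mcoeffU; case: (k =P l) => [<- //|_].
by rewrite eqxx.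
Qed.

End LinearCombinations.

(** * Partitions as sequences of positive parts *)

Lemma intpart_gt0 (la : intpart) x : x \in (la : seq nat) -> (0 < x)%N.
Proof.
by case/andP: (partsP la) => _ n0 xla; rewrite lt0n; apply: contraNneq n0 => <-.
Qed.

Lemma nth_intpart_gt0 (la : intpart) i : (0 < nth 0%N la i)%N = (i < size la)%N.
Proof.
case: (ltnP i) => [lt_i|le_i]; last by rewrite nth_default.
by apply: (@intpart_gt0 la); rewrite mem_nth.
Qed.

Lemma eq_intpart (la mu : intpart) : nth 0%N la =1 nth 0%N mu -> la = mu.
Proof.
move=> e; apply: val_inj; apply: (@eq_from_nth _ 0%N) => [|i _]; last exact: e.
have lt_size i : (i < size la)%N = (i < size mu)%N.
  by rewrite -!nth_intpart_gt0 e.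
by apply/eqP; rewrite eqn_leq leqNgt lt_size ltnn leqNgt -lt_size ltnn.
Qed.

Lemma perm_intpart (la mu : intpart) : perm_eq la mu -> la = mu.
Proof.
move=> e; apply: val_inj; apply: (sorted_eq (leT := geq)) => //.
- by move=> x y z /= xy yz; apply: leq_trans yz xy.
- by move=> x y /=; rewrite andbC; apply: anti_leq.
- by case/andP: (partsP la).
- by case/andP: (partsP mu).
Qed.

(** * Coefficients of a symmetric function indexed by partitions *)

Section MonomialCoefficients.
Implicit Types (f g : SymFun) (la mu : intpart).

Definition pad la N : 'X_{1..N} := [multinom nth 0%N la i | i < N].

(** The coefficient of [m_ la] in [f], read off in the least number of variables in which the
    monomial of exponent [la] exists. *)
Definition mcoef la f : K^o := (symfam f (size la))@_(pad la (size la)).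

(** Setting the last variable to 0 preserves the coefficients of the monomials free of it, and
    padding only appends zero exponents. *)
Lemma mcoef_pad f la N : (size la <= N)%N -> (symfam f N)@_(pad la N) = mcoef la f.
Proof.
move=> /subnKC <-; elim: (N - _)%N => [|k IHk]; first by rewrite addn0.
have /asboolP[_ stab _] := symfamP f.
rewrite addnS -IHk -[in RHS](stab (size la + k)%N) mcoeff_set_last0; congr (_@_ _).
apply/mnmP => i; rewrite !mnmE; case: unliftP => [j ->|->] /=.
  by rewrite mnmE /= /bump leqNgt ltn_ord.
by rewrite nth_default // leq_addr.
Qed.

Fact part_subproof (s : seq nat) : is_part (sort geq [seq x <- s | x != 0%N]).
Proof.
rewrite /is_part sort_sorted; last by move=> x y; apply: leq_total.
by rewrite mem_sort mem_filter eqxx.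
Qed.

Definition part (s : seq nat) : intpart := IntPart (part_subproof s).

Lemma size_part s : (size (part s) <= size s)%N.
Proof. by rewrite size_sort size_filter count_size. Qed.

Lemma psize_part s : psize (part s) = sumn s.
Proof.
rewrite /psize (perm_sumn (permEl (perm_sort _ _))).
by elim: s => //= x s IHs; case: eqP => /= [->|_]; rewrite IHs.
Qed.

Lemma perm_part s :
  perm_eq (part s ++ nseq (size s - size (part s)) 0%N) s.
Proof.
rewrite perm_sym -(perm_filterC (fun x => x != 0%N) s).
apply: perm_cat; first by rewrite perm_sym perm_sort.
rewrite size_sort -[X in nseq (X - _)](count_predC (fun x => x != 0%N)).
rewrite size_filter addKn -size_filter.
suff /all_pred1P <- : all (pred1 0%N) [seq x <- s | predC (fun x => x != 0%N) x].
  exact: perm_refl.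
by apply/allP => x; rewrite mem_filter /= negbK => /andP[].
Qed.

(** Symmetry allows the exponents to be sorted and stability allows the zeros to be dropped. *)
Lemma mcoefE f N (m : 'X_{1..N}) : (symfam f N)@_m = mcoef (part m) f.
Proof.
have size_m : size m = N by rewrite size_tuple.
have le_N : (size (part m) <= N)%N by rewrite -[X in (_ <= X)%N]size_m size_part.
rewrite -(mcoef_pad f le_N).
(* Padded back to length [N], the sorted exponent is a rearrangement of [m]; the rearranging
   permutation is then absorbed by the symmetry of [f] in [N] variables. *)
have : perm_eq (pad (part m) N) m.
  have -> : pad (part m) N = part m ++ nseq (N - size (part m)) 0%N :> seq nat.
    apply: (@eq_from_nth _ 0%N) => [|i].
      by rewrite size_tuple size_cat size_nseq subnKC.
    rewrite size_tuple => lt_i; rewrite -[i]/(nat_of_ord (Ordinal lt_i)) -mnm_nth.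
    rewrite mnmE /= nth_cat nth_nseq; case: ltnP => [//|le_i].
    by rewrite nth_default //; case: ifP.
  by rewrite -[X in nseq (X - _)]size_m perm_part.
rewrite perm_sym => /tuple_permP[u mE]; have /asboolP[sym _ _] := symfamP f.
rewrite -[in RHS](issymP _ (sym N) u) mcoeff_sym; congr (_@_ _).
apply/mnmP => i; rewrite mnmE (mnm_nth 0%N) [in LHS]mE -tnth_nth tnth_mktuple.
by rewrite -mnm_tnth.
Qed.

End MonomialCoefficients.

(** * Expansion in monomial symmetric functions *)

Section MonomialBasis.
Implicit Types (f g : SymFun) (la mu : intpart).

Fact mcoef_is_linear la : linear (mcoef la).
Proof. by move=> c f g; rewrite /mcoef mcoeffD mcoeffZ. Qed.

HB.instance Definition _ la :=
  GRing.isLinear.Build K SymFun K^o _ (mcoef la) (mcoef_is_linear la).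

Lemma mcoefZ la c f : mcoef la (c *: f) = c * mcoef la f.
Proof. exact: linearZ. Qed.

Lemma eq_mcoef f g : (forall la, mcoef la f = mcoef la g) -> f = g.
Proof.
move=> e; apply: val_inj; apply: functional_extensionality_dep => N.
by apply/mpolyP => m; rewrite !mcoefE.
Qed.

Lemma filter_pad la : [seq x <- pad la (size la) | x != 0%N] = la.
Proof.
have -> : pad la (size la) = la :> seq nat.
  apply: (@eq_from_nth _ 0%N) => [|i]; rewrite size_tuple // => lt_i.
  by rewrite -[i]/(nat_of_ord (Ordinal lt_i)) -mnm_nth mnmE.
by apply/all_filterP/allP => x /intpart_gt0; rewrite lt0n.
Qed.

Lemma mcoef_m la mu : mcoef mu (m_ la) = (mu == la)%:R.
Proof.
rewrite /mcoef mcoeff_mono filter_pad; congr (nat_of_bool _)%:R.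
by apply/idP/eqP => [/perm_intpart|->].
Qed.

Lemma mdeg_sumn N (m : 'X_{1..N}) : mdeg m = sumn m.
Proof.
by rewrite sumnE mdegE big_tuple; apply: eq_bigr => i _; rewrite mnm_tnth.
Qed.

Lemma part_pad la : part (pad la (size la)) = la.
Proof.
by apply: perm_intpart; rewrite perm_sort filter_pad.
Qed.

Lemma homdegP n f :
  f \in homdeg n <-> (forall la, mcoef la f != 0 -> psize la = n).
Proof.
split=> [/asboolP hf la|hf].
  have /dhomogP := hf (size la) => /(_ (pad la (size la))).
  rewrite mcoeff_msupp => h /h /= <-.
  by rewrite -[in LHS](part_pad la) psize_part -mdeg_sumn.
apply/asboolP => N; apply/dhomogP => m; rewrite mcoeff_msupp mcoefE => /hf <-.
by rewrite psize_part -mdeg_sumn.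
Qed.

(** The degree of [f] is bounded uniformly in the number of variables, and there are finitely many
    partitions below a given size. *)
Lemma mcoef_finite f : exists D : {fset intpart}, forall la,
  mcoef la f != 0 -> la \in D.
Proof.
have /asboolP[_ _ [d le_d]] := symfamP f.
have fin : finite_set (\bigcup_(n in `I_d) [set la | psize la = n])%classic.
  by apply: bigcup_finite => [|n _]; [apply: finite_II|apply: finite_parts].
exists (fset_set (\bigcup_(n in `I_d) [set la | psize la = n])%classic) => la nz.
rewrite in_fset_set //; apply/mem_set; exists (psize la) => //=.
apply: leq_trans (le_d (size la)).
rewrite -[X in psize X]part_pad psize_part -mdeg_sumn.
by apply: msize_mdeg_lt; rewrite mcoeff_msupp.
Qed.

Lemma mcoef_expand f (D : {fset intpart}) :
  (forall la, mcoef la f != 0 -> la \in D) ->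
  f = \sum_(la <- D) mcoef la f *: m_ la.
Proof.
move=> subD; apply: eq_mcoef => mu; rewrite linear_sum /=.
under eq_bigr do rewrite mcoefZ mcoef_m.
have [muD|/negP muD] := boolP (mu \in D).
  rewrite (big_fsetD1 mu) //= eqxx mulr1 big1_seq ?addr0 // => la /=.
  by rewrite !inE eq_sym => /andP[/negPf -> _]; rewrite mulr0.
have [/subD //|/negPn/eqP ->] := boolP (mcoef mu f != 0).
rewrite big1_seq // => la /= laD; case: eqP => [e|_]; last by rewrite mulr0.
by case: muD; rewrite e.
Qed.
End MonomialBasis.

(** * Bases from triangularity on the monomial functions *)

Definition is_basis (B : intpart -> SymFun) : Prop :=
  (forall f, exists a, f = lincomb B a) /\
  (forall a, lincomb B a = 0 -> a = 0).

Section Triangularity.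
Variables (B : intpart -> SymFun) (rank : intpart -> nat).
Hypothesis homB : forall la, B la \in homdeg (psize la).
Hypothesis diagB : forall la, mcoef la (B la) != 0.
Hypothesis triB : forall la mu,
  mcoef mu (B la) != 0 -> mu = la \/ (rank mu < rank la)%N.

(** Strong induction on the rank: the expansion of [B la] is solved for [m_ la], and the other
    monomial functions in it have smaller rank. Homogeneity of [B la] keeps the sizes equal. *)
Lemma m_spanned la : spanned (fun mu => psize mu = psize la) B (m_ la).
Proof.
have [r] := ubnP (rank la); elim: r la => // r IHr la /ltnSE le_r.
have [D subD] := mcoef_finite (B la).
have laD : la \in D by apply: subD.
have mE : mcoef la (B la) *: m_ la =
    B la - \sum_(mu <- (D `\ la)%fset) mcoef mu (B la) *: m_ mu.
  by rewrite {2}(mcoef_expand subD) (big_fsetD1 la) //= addrK.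
have -> : m_ la = (mcoef la (B la))^-1 *: (B la
    - \sum_(mu <- (D `\ la)%fset) mcoef mu (B la) *: m_ mu).
  by rewrite -mE scalerA mulVf ?scale1r.
apply: spannedZ; rewrite addrC -scaleN1r.
apply: spannedP; last exact: spanned_gen.
apply: spanned_sum => mu; rewrite !inE => /andP[/eqP ne_mu _] _.
have [nz|/negPn/eqP ->] := boolP (mcoef mu (B la) != 0); last first.
  by rewrite scale0r; apply: spanned0.
have [//|lt_mu] := triB nz; apply: spannedZ.
rewrite -(proj1 (homdegP _ _) (homB la) _ nz).
by apply: IHr; apply: leq_trans le_r.
Qed.

Lemma homdeg_spanned n f :
  f \in homdeg n -> spanned (fun mu => psize mu = n) B f.
Proof.
move=> /homdegP hf; have [D subD] := mcoef_finite f.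
rewrite (mcoef_expand subD); apply: spanned_sum => la _ _.
have [nz|/negPn/eqP ->] := boolP (mcoef la f != 0); last first.
  by rewrite scale0r; apply: spanned0.
by apply: spannedZ; rewrite -(hf _ nz); apply: m_spanned.
Qed.

Lemma triangular_basis : is_basis B.
Proof.
split=> [f|a a0].
  have [D subD] := mcoef_finite f.
  suff [a _ ->] : spanned (fun=> True) B f by exists a.
  rewrite (mcoef_expand subD); apply: spanned_sum => la _ _; apply: spannedZ.
  by case: (m_spanned la) => b _ mE; exists b; [move=> k _; exact: I|exact: mE].
apply: contrapT => nz_a.
have [la0 la0a] : exists la, la \in monalg.msupp a.
  apply: contrapT => /forallNP noa; apply: nz_a; apply/monalg.malgP => k.
  by rewrite monalg.mcoeff0; apply: monalg.mcoeff_outdom; apply/negP/noa.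
(* For independence, take an index of maximal rank in the support of a vanishing combination: no
   other term contributes to its monomial coefficient, which is therefore both zero and nonzero. *)
have [la laa max_la] : exists2 la, la \in monalg.msupp a &
    forall mu, mu \in monalg.msupp a -> (rank mu <= rank la)%N.
  pose la1 : monalg.msupp a := [` la0a]%fset.
  case: (@arg_maxnP _ la1 predT (fun x => rank (val x))) => // la _ max_la.
  exists (val la); first exact: valP.
  by move=> mu mua; apply: (max_la [` mua]%fset).
have := congr1 (mcoef la) a0; rewrite /lincomb linear_sum linear0 /=.
rewrite (big_fsetD1 la) //= big1_seq => [|mu /andP[_]].
  rewrite addr0 mcoefZ => /eqP; rewrite mulf_eq0 (negPf (diagB la)) orbF.
  by rewrite monalg.mcoeff_eq0 laa.
rewrite !inE => /andP[/eqP ne_mu mua]; rewrite mcoefZ.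
have [nz|/negPn/eqP ->] := boolP (mcoef la (B mu) != 0); last by rewrite mulr0.
have [e|] := triB nz; first by case: ne_mu.
by rewrite ltnNge max_la.
Qed.

End Triangularity.

(** * Coordinates on a basis *)

Section Coordinates.
Variable B : intpart -> SymFun.
Hypothesis basisB : is_basis B.

Lemma lincomb_inj : injective (lincomb B).
Proof.
move=> a b e; apply/eqP; rewrite -subr_eq0; apply/eqP.
by apply: basisB.2; rewrite linearB /= e subrr.
Qed.

Lemma coordK f : lincomb B (coord B f) = f.
Proof.
(* The default value of [xget] is excluded because [B] spans. *)
rewrite /coord; case: xgetP => [a _ /= -> //|noa].
by have [a aE] := basisB.1 f; have := noa a.
Qed.

Lemma lincombK a : coord B (lincomb B a) = a.
Proof. by apply: lincomb_inj; rewrite coordK. Qed.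

Lemma coord_linear : linear (coord B).
Proof. by move=> c f g; apply: lincomb_inj; rewrite linearP /= !coordK. Qed.

Lemma coord_gen la : coord B (B la) = monalg.mkmalgU la 1.
Proof. by rewrite -[B la]scale1r -lincombU lincombK. Qed.

Lemma linext_linear (V : lmodType K) (g : intpart -> V) : linear (linext B g).
Proof.
by move=> c u v; rewrite -![linext B g _]/(lincomb g _) coord_linear linearP.
Qed.

End Coordinates.

(** * Nonvanishing of the scalars in the field of rational functions *)

Lemma natK_neq0 n : (0 < n)%N -> n%:R != 0 :> K.
Proof.
move=> n0; rewrite -(rmorph_nat (@FracField.tofrac {mpoly rat[2]})).
rewrite tofrac_eq0; apply/eqP => /(congr1 (mcoeff 0%MM)) /eqP.
rewrite mcoeff0 -mpolyC_nat mcoeffC eqxx mulr1 Num.Theory.pnatr_eq0.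
by rewrite -leqn0 leqNgt n0.
Qed.

(** Evaluation at q = t = 0 gives 1, as the monomial is not constant. *)
Lemma one_sub_qt_neq0 a b : (0 < a + b)%N -> 1 - q ^+ a * t ^+ b != 0.
Proof.
move=> ab; pose p : {mpoly rat[2]} := 1 - 'X_0 ^+ a * 'X_1 ^+ b.
have -> : 1 - q ^+ a * t ^+ b = @FracField.tofrac {mpoly rat[2]} p.
  by rewrite /p rmorphB rmorphM !rmorphXn rmorph1.
rewrite tofrac_eq0; apply/eqP => /(congr1 (meval (fun=> 0))) /eqP.
rewrite meval0 /p mevalB mevalM !rmorphXn /= !mevalXU meval1 -exprD expr0n.
by rewrite -leqn0 leqNgt ab subr0 oner_eq0.
Qed.

Lemma c_neq0 la : c_ la != 0.
Proof.
apply/prodf_neq0 => i _; apply/prodf_neq0 => j _; apply: one_sub_qt_neq0.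
by rewrite addnS.
Qed.

Lemma weight_neq0 la : weight la != 0.
Proof.
rewrite /weight mulf_neq0 //.
  apply: natK_neq0; rewrite /z_ big_seq; elim/big_ind: _ => // [m n m0 n0|k].
    by rewrite muln_gt0 m0.
  rewrite mem_undup => /intpart_gt0 k0.
  by rewrite muln_gt0 expn_gt0 k0 fact_gt0.
rewrite big_seq; elim/big_ind: _ => [|x y x0 y0|k /intpart_gt0 k0].
- exact: oner_neq0.
- exact: mulf_neq0.
- rewrite mulf_neq0 ?invr_neq0 //.
    by rewrite -[q ^+ k]mulr1 -(expr0 t) one_sub_qt_neq0 ?addn0.
  by rewrite -[t ^+ k]mul1r -(expr0 q) one_sub_qt_neq0.
Qed.

(** * Power sums form a basis *)

Section PowerSums.
Implicit Types la mu : intpart.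

Lemma p_homog la : p_ la \in homdeg (psize la).
Proof.
apply/asboolP => N; rewrite /p_ /psize.
have : all (fun k => 0 < k)%N la by apply/allP => k /intpart_gt0.
elim: (la : seq nat) => /= [_|k s IHs /andP[k0 /IHs homs]].
  by rewrite big_nil; apply: dhomog1.
rewrite big_cons; apply: dhomogM => //.
by rewrite -[X in X.-homog](prednK k0); apply: psum_homog.
Qed.

Lemma symfam_prod (T : Type) (r : seq T) (F : T -> SymFun) N :
  symfam (\prod_(x <- r) F x) N = \prod_(x <- r) symfam (F x) N.
Proof. by elim: r => [|x r IHr]; rewrite ?big_nil // !big_cons -IHr. Qed.

(** Expanding the product of power sums picks a variable [f j] for each part of [la]; the resulting
    monomial has exponent [mu] exactly when the parts sent to [i] add up to the [i]-th part of
    [mu]. *)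
Lemma mcoef_p la mu : mcoef mu (p_ la) =
  #|[set f : {ffun 'I_(size la) -> 'I_(size mu)} |
     [forall i : 'I_(size mu), nth 0%N mu i == \sum_(j | f j == i) nth 0%N la j]%N]|%:R.
Proof.
rewrite /mcoef /p_ symfam_prod (big_nth 0%N) big_mkord.
have -> : \prod_(j < size la) symfam (psum (nth 0%N la j).-1) (size mu) =
    \prod_(j < size la) \sum_(i < size mu) 'X_i ^+ nth 0%N la j.
  apply: eq_bigr => j _; rewrite /= prednK // nth_intpart_gt0.
  exact: ltn_ord.
rewrite bigA_distr_bigA raddf_sum /= -sum1_card natr_sum [RHS]big_mkcond /=.
apply: eq_bigr => f _; rewrite inE.
have -> : \prod_(j < size la) 'X_(f j) ^+ nth 0%N la j =
    'X_[K, [multinom (\sum_(j | f j == i) nth 0%N la j)%N | i < size mu]].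
  rewrite [RHS]mpolyXE_id (partition_big f xpredT) //=.
  apply: eq_bigr => i _; rewrite mnmE -prodrXr.
  by apply: eq_bigr => j /eqP ->.
rewrite mcoeffX; case: forallP => [mE|no]; last first.
  case: eqP => // e; case: no => i.
  by rewrite -[X in _ == X](mnmE (fun i => \sum_(j | f j == i) nth 0%N la j)%N) e mnmE.
case: eqP => // -[]; apply/mnmP => i; rewrite !mnmE.
by apply/esym/eqP.
Qed.

Lemma p_diag la : mcoef la (p_ la) != 0.
Proof.
(* The identity is one of the maps counted. *)
rewrite mcoef_p natK_neq0 //; apply/card_gt0P; exists [ffun i => i].
rewrite inE; apply/forallP => i; under eq_bigl do rewrite ffunE.
by rewrite big_pred1_eq.
Qed.

Lemma p_tri la mu :
  mcoef mu (p_ la) != 0 -> mu = la \/ (size mu < size la)%N.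
Proof.
rewrite mcoef_p => nz.
(* The entries of mu are sums of parts of la over nonempty disjoint blocks. *)
have /card_gt0P[f] : (0 < #|[set f : {ffun 'I_(size la) -> 'I_(size mu)} |
     [forall i : 'I_(size mu), nth 0%N mu i == \sum_(j | f j == i) nth 0%N la j]%N]|)%N.
  by rewrite lt0n; apply: contraNneq nz => ->.
rewrite inE => /forallP fE.
(* An empty block would have sum 0, whereas the parts of [mu] are positive. *)
have surj i : exists j, f j == i.
  apply/existsP; apply: contraT; rewrite negb_exists => /forallP nof.
  have := nth_intpart_gt0 mu i; rewrite ltn_ord (eqP (fE i)) big_pred0 //.
  by move=> j; apply/negbTE.
have fK : cancel (fun i => xchoose (surj i)) f.
  by move=> i; apply/eqP/(xchooseP (surj i)).
have := leq_card _ (can_inj fK); rewrite !card_ord.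
rewrite leq_eqVlt => /predU1P[e|]; [left|by right].
(* With equal lengths the surjection [f] is a bijection, every block is a single part, and [mu] is a
   rearrangement of [la]. *)
have inj_f : injective f.
  by apply/bij_inj/(bij_can_bij _ fK)/(inj_card_bij (can_inj fK)); rewrite !card_ord e.
apply: perm_intpart.
have nthE (s : seq nat) : s = [seq nth 0%N s i | i : 'I_(size s) <- enum 'I_(size s)].
  by rewrite -[LHS](mkseq_nth 0%N) /mkseq -val_enum_ord -map_comp.
rewrite (nthE la) (nthE mu).
have -> : [seq nth 0%N la j | j : 'I_(size la) <- enum 'I_(size la)] =
    [seq nth 0%N mu i | i : 'I_(size mu) <- [seq f j | j <- enum 'I_(size la)]].
  rewrite -[RHS]map_comp; apply: eq_map => j /=; rewrite (eqP (fE (f j))).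
  by rewrite (big_pred1 j) // => k; rewrite (inj_eq inj_f).
apply: perm_map; apply: uniq_perm => [||i]; rewrite ?enum_uniq //.
  by rewrite map_inj_uniq ?enum_uniq.
rewrite mem_enum; apply/esym/mapP; have [j /eqP fj] := surj i.
by exists j; rewrite ?mem_enum.
Qed.

Lemma p_basis : is_basis p_.
Proof. exact: (triangular_basis p_homog p_diag p_tri). Qed.
End PowerSums.

(** * A numerical rank for the dominance order *)

Section DominanceOrder.
Implicit Types la mu : intpart.

(** Dominance compares partial sums one by one, so their total is monotone; the range covers all of
    them since a partition has at most [psize la] parts. *)
Definition dom_rank la : nat := (\sum_(k < (psize la).+1) sumn (take k la))%N.

Lemma size_le_psize la : (size la <= psize la)%N.
Proof.
rewrite /psize; have : all (fun k => 0 < k)%N la.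
  by apply/allP => k /intpart_gt0.
elim: (la : seq nat) => //= k s IHs /andP[k0 /IHs]; rewrite -add1n.
exact: leq_add.
Qed.

Lemma eq_take_intpart la mu : psize la = psize mu ->
  (forall k, (k < (psize la).+1)%N -> sumn (take k la) = sumn (take k mu)) ->
  la = mu.
Proof.
move=> e eq_take.
have {}eq_take k : sumn (take k la) = sumn (take k mu).
  have [/eq_take //|lt_k] := ltnP k (psize la).+1.
  rewrite !take_oversize //.
    by apply: leq_trans (size_le_psize mu) _; rewrite -e ltnW.
  by apply: leq_trans (size_le_psize la) _; rewrite ltnW.
apply: eq_intpart => i.
have sumn_take s : sumn (take i.+1 s) = (sumn (take i s) + nth 0%N s i)%N.
  elim: s i {eq_take} => [|x s IHs] [|i] //=; first by rewrite take0 addn0.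
  by rewrite IHs addnA.
by apply/eqP; rewrite -(eqn_add2l (sumn (take i la))) -sumn_take eq_take sumn_take eq_take.
Qed.

Lemma dom_lt_rank la mu : dom_lt mu la -> (dom_rank mu < dom_rank la)%N.
Proof.
move=> [ne e le_mu]; rewrite /dom_rank e ltn_neqAle leq_sum ?andbT => [|k _ //].
apply/eqP => eq_sum; apply: ne; apply: eq_take_intpart => // k; rewrite e => lt_k.
(* Equal totals of termwise ordered sums force all partial sums to agree, and these determine the
   partition. *)
have [_] := leqif_sum (fun (i : 'I_(psize la).+1) (_ : true) =>
  leqif_eq (le_mu i)).
rewrite eq_sum eqxx => /esym/forallP/(_ (Ordinal lt_k)).
by move/eqP.
Qed.
End DominanceOrder.

(** * The Macdonald scalar product and its tensor square *)

Section ScalarProduct.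
Implicit Types F G H : SymFun.

Lemma coordP la c F G : monalg.mcoeff la (coord p_ (c *: F + G)) =
  c * monalg.mcoeff la (coord p_ F) + monalg.mcoeff la (coord p_ G).
Proof. by rewrite (coord_linear p_basis) monalg.mcoeffD monalg.mcoeffZ. Qed.

Lemma form_sym F G : form F G = form G F.
Proof.
have formE F' G' (D : {fset intpart}) :
    (monalg.msupp (coord p_ F') `<=` D)%fset -> form F' G' = \sum_(la <- D)
      monalg.mcoeff la (coord p_ F') * monalg.mcoeff la (coord p_ G') *
      weight la.
  move=> subD; apply: big_fset_incl => // la _ /monalg.mcoeff_outdom ->.
  by rewrite !mul0r.
(* [form] sums over the support of its first argument only; over the union of both supports the sum
   is visibly symmetric. *)
pose D := (monalg.msupp (coord p_ F) `|` monalg.msupp (coord p_ G))%fset.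
rewrite (formE F G D) ?fsubsetUl // (formE G F D) ?fsubsetUr //.
by apply: eq_bigr => la _; congr (_ * _); apply: mulrC.
Qed.

Fact form_is_linear F : linear (form F : SymFun -> K^o).
Proof.
move=> c G H; rewrite /form scaler_sumr -big_split /=; apply: eq_bigr => la _.
rewrite coordP; move: (weight la) => w.
by rewrite mulrDr mulrDl mulrCA -[X in X + _]mulrA.
Qed.

HB.instance Definition _ F :=
  GRing.isLinear.Build K SymFun K^o _ (form F) (form_is_linear F).

Lemma formZl c F H : form (c *: F) H = c * form F H.
Proof. by rewrite !(form_sym _ H); apply: linearZ. Qed.

Lemma formZr c F H : form H (c *: F) = c * form H F.
Proof. exact: linearZ. Qed.

Lemma form_suml (T : Type) (r : seq T) (f : T -> SymFun) H :
  form (\sum_(x <- r) f x) H = \sum_(x <- r) form (f x) H.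
Proof.
by rewrite form_sym linear_sum; apply: eq_bigr => x _; apply: form_sym.
Qed.

(** Pairing with [p_ la] gives the [la]-coordinate of [G] times a nonzero weight. *)
Lemma form_nondeg G : (forall F, form F G = 0) -> G = 0.
Proof.
move=> G0; rewrite -(coordK p_basis G).
suff -> : coord p_ G = 0 by apply: linear0.
apply/monalg.malgP => la; rewrite monalg.mcoeff0; have := G0 (p_ la).
rewrite /form (coord_gen p_basis) monalg.msuppU oner_eq0 big_seq_fset1.
rewrite monalg.mcoeffUU mul1r => /eqP; rewrite mulf_eq0 (negPf (weight_neq0 la)).
by rewrite orbF => /eqP.
Qed.

Lemma sum_msupp_delta (I : choiceType) (a : monalg.malg I K) k0 :
  \sum_(k <- monalg.msupp a) monalg.mcoeff k a *+ (k == k0) = monalg.mcoeff k0 a.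
Proof.
rewrite [in RHS](monalg.monalgE a) raddf_sum; apply: eq_bigr => k _.
by rewrite [RHS]monalg.mcoeffU.
Qed.

Lemma mcoeff_tens F G la mu : monalg.mcoeff (la, mu) (tens F G) =
  monalg.mcoeff la (coord p_ F) * monalg.mcoeff mu (coord p_ G).
Proof.
rewrite -(sum_msupp_delta (coord p_ F)) -(sum_msupp_delta (coord p_ G)).
rewrite /tens raddf_sum mulr_suml; apply: eq_bigr => la' _.
rewrite raddf_sum mulr_sumr; apply: eq_bigr => mu' _.
by rewrite [LHS]monalg.mcoeffU xpair_eqE mulrnAl mulrnAr -mulrnA mulnb andbC.
Qed.

Lemma form2E S T : form2 S T = lincomb (fun k =>
  monalg.mcoeff k T * (weight k.1 * weight k.2) : K^o) S.
Proof. by apply: eq_bigr => k _; rewrite -mulrA. Qed.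

Lemma form2_tens F G F' G' :
  form2 (tens F G) (tens F' G') = form F F' * form G G'.
Proof.
rewrite form2E /tens linear_sum /form mulr_suml; apply: eq_bigr => la _.
rewrite linear_sum mulr_sumr; apply: eq_bigr => mu _.
rewrite /= lincombU mcoeff_tens /=.
by rewrite [RHS]mulrACA [X in _ = X * _]mulrACA -[RHS]mulrA.
Qed.

Fact form2_is_linear S : linear (form2 S : SymTens -> K^o).
Proof.
move=> c T U; rewrite /form2 scaler_sumr -big_split /=; apply: eq_bigr => k _.
rewrite monalg.mcoeffD monalg.mcoeffZ; move: (weight k.1 * weight k.2) => w.
by rewrite mulrDr mulrDl mulrCA -[X in X + _]mulrA.
Qed.

HB.instance Definition _ S :=
  GRing.isLinear.Build K SymTens K^o _ (form2 S) (form2_is_linear S).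

End ScalarProduct.

(** * Macdonald functions, their duals and the product *)

Section MacdonaldBasis.
Variable P : intpart -> SymFun.
Hypothesis macP : is_macdonald P.
Implicit Types (la mu : intpart) (F G H : SymFun).

Lemma finite_dom_lt la : finite_set [set mu | dom_lt mu la]%classic.
Proof. by apply: sub_finite_set (finite_parts (psize la)) => mu []. Qed.

Lemma mcoef_P la mu :
  mcoef mu (P la) != 0 -> mu = la \/ dom_lt mu la.
Proof.
have [u ->] := macP.1 la; rewrite linearD /= mcoef_m.
have [->|/eqP ne_mu] := eqVneq mu la; [by left|rewrite add0r => nz; right].
apply: contrapT => no_lt; move/eqP: nz; apply.
rewrite fsbig_finite; last exact: finite_dom_lt.
rewrite linear_sum big1_seq // => nu /andP[_].
rewrite in_fset_set; last exact: finite_dom_lt.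
move=> /set_mem /= lt_nu; rewrite [LHS]mcoefZ mcoef_m.
by case: eqP => [e|_]; [case: no_lt; rewrite e|rewrite mulr0].
Qed.

Lemma mcoef_P_diag la : mcoef la (P la) = 1.
Proof.
have [u ->] := macP.1 la; rewrite linearD /= mcoef_m eqxx.
rewrite fsbig_finite; last exact: finite_dom_lt.
rewrite linear_sum big1_seq ?addr0 // => nu /andP[_].
rewrite in_fset_set; last exact: finite_dom_lt.
move=> /set_mem /= [ne_nu _ _]; rewrite [LHS]mcoefZ mcoef_m.
by case: eqP => [e|_]; [case: ne_nu|rewrite mulr0].
Qed.

Lemma P_homog la : P la \in homdeg (psize la).
Proof. by apply/homdegP => mu /mcoef_P[->|[]]. Qed.

Lemma P_diag la : mcoef la (P la) != 0.
Proof. by rewrite mcoef_P_diag oner_eq0. Qed.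

Lemma P_tri la mu :
  mcoef mu (P la) != 0 -> mu = la \/ (dom_rank mu < dom_rank la)%N.
Proof. by move=> /mcoef_P[|/dom_lt_rank]; [left|right]. Qed.

Lemma P_basis : is_basis P.
Proof. exact: (triangular_basis P_homog P_diag P_tri). Qed.

Lemma J_basis : is_basis (J_ P).
Proof.
apply: (triangular_basis (rank := dom_rank)) => [la|la|la mu].
- by apply: rpredZ; apply: P_homog.
- by rewrite mcoefZ mulf_neq0 ?c_neq0 ?P_diag.
- by rewrite mcoefZ mulf_eq0 negb_or => /andP[_ /P_tri].
Qed.

Definition norm la : K := form (P la) (P la).

Lemma form_P la mu : form (P la) (P mu) = (la == mu)%:R * norm la.
Proof.
by have [->|/eqP/macP.2 ->] := eqVneq la mu; rewrite ?mul1r ?mul0r.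
Qed.

Lemma form_P_nondeg G : (forall la, form (P la) G = 0) -> G = 0.
Proof.
move=> G0; apply: form_nondeg => F; rewrite -(coordK P_basis F) form_suml.
by rewrite big1 // => la _; rewrite formZl G0 mulr0.
Qed.

(** A [P la] of norm zero would be orthogonal to the whole basis, hence zero, against its leading
    coefficient 1. *)
Lemma norm_neq0 la : norm la != 0.
Proof.
apply/eqP => n0; have /eqP := P_diag la; apply.
rewrite (_ : P la = 0) ?linear0 //; apply: form_P_nondeg => mu.
by rewrite form_P; case: eqP => [->|_]; rewrite ?n0 ?mulr0 ?mul0r.
Qed.

(** The pairings with the remaining [P la] vanish anyway, since [F] is a combination of the [P mu]
    of size [n]. *)
Lemma form_P_eq0 n F : F \in homdeg n ->
  (forall la, psize la = n -> form F (P la) = 0) -> F = 0.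
Proof.
move=> /(homdeg_spanned P_homog P_diag P_tri)[a homa ->] orth.
apply: form_P_nondeg => la; rewrite form_sym.
have [/homa/orth //|/negPn/eqP a0] := boolP (monalg.mcoeff la a != 0).
rewrite form_suml big1 // => mu _; rewrite formZl form_P.
by case: eqP => [->|_]; rewrite ?a0 ?mul0r ?mulr0.
Qed.

Lemma QE la : Q_ P la = (norm la)^-1 *: P la.
Proof.
have formQ mu : form (P mu) ((norm la)^-1 *: P la) = (mu == la)%:R.
  rewrite formZr form_P; case: eqP => [->|_]; last by rewrite mul0r mulr0.
  by rewrite mul1r mulVf ?norm_neq0.
(* Nondegeneracy identifies the element chosen by [xget] with the rescaled [P la], which also shows
   that the defining set is nonempty. *)
rewrite /Q_; case: xgetP => [G _ [_ formG]|/(_ ((norm la)^-1 *: P la))[]].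
  apply/eqP; rewrite -subr_eq0; apply/eqP; apply: form_P_nondeg => mu.
  by rewrite linearB /= formG formQ subrr.
by split=> //; apply: rpredZ; apply: P_homog.
Qed.

Lemma form_QJ la mu : form (Q_ P la) (J_ P mu) = (la == mu)%:R * c_ la.
Proof.
rewrite QE formZl formZr form_P; case: eqP => [<-|_].
  by rewrite !mul1r mulrCA mulVf ?mulr1 ?norm_neq0.
by rewrite !mul0r !mulr0.
Qed.

Lemma Q_neq0 la : Q_ P la != 0.
Proof.
apply/eqP => Q0; have := form_QJ la la; rewrite Q0 eqxx mul1r form_sym linear0.
by move=> /esym/eqP; rewrite (negPf (c_neq0 la)).
Qed.

Lemma qtprod_uniq n F G R : R \in homdeg n ->
  (forall H, H \in homdeg n -> form R H = form2 (tens F G) (Gamma P n H)) ->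
  qtprod P n F G = R.
Proof.
move=> homR formR; rewrite /qtprod; case: xgetP => [R' _ [homR' formR']|/(_ R)[]//].
apply/eqP; rewrite -subr_eq0; apply/eqP; apply: (@form_P_eq0 n) => [|la e].
  exact: rpredB.
rewrite form_sym linearB /= !(form_sym (P la)) formR ?formR' ?subrr //.
all: by rewrite -e P_homog.
Qed.

Lemma qtprod_Q n F la : psize la = n ->
  qtprod P n F (Q_ P la) = (form F (J_ P la) / n`!%:R) *: Q_ P la.
Proof.
move=> e; apply: qtprod_uniq => [|H _].
  by apply: rpredZ; rewrite -e; apply: Q_homog.
(* With [H] expanded on the [J_ P mu], both sides are compared term by term, and only [mu = la]
   contributes. *)
rewrite -[Gamma P n H]/(lincomb _ (coord (J_ P) H)) -{1}(coordK J_basis H).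
rewrite !linear_sum /=; apply: eq_bigr => mu _.
rewrite formZr formZl form_QJ.
rewrite [RHS]linearZ /= [X in _ *: X]linearZ /= form2_tens form_QJ.
case: eqP => [<-|_]; last by rewrite !mul0r !mulr0 ?scaler0.
by rewrite [_ / _]mulrC -[X in _ * X = _]mulrA.
Qed.

End MacdonaldBasis.

(** * Pairings of the hat transform with the integral forms *)

Section HatTransform.
Variables (P : intpart -> SymFun) (Ps : intpart -> forall N : nat, {mpoly K[N]}).
Hypotheses (macP : is_macdonald P) (shiftP : is_shifted_macdonald Ps).
Implicit Types (la mu : intpart) (F G H : SymFun).

Lemma Pstar_at_eq0 la mu : (psize la < psize mu)%N -> Pstar_at Ps mu la = 0.
Proof.
move=> lt_la; have [_ _ _ vanish _] := shiftP (leq_maxl (size mu) (size la)).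
apply: vanish; [|exact: ltnW|exact: leq_maxr].
by move=> e; move: lt_la; rewrite e ltnn.
Qed.

(** Only the term of index [la] survives, and its denominator [c_ la] cancels the pairing of
    [Q_ P la] with [J_ P la]. *)
Lemma form_hatP_comp n la mu : psize la = n ->
  form (hatP_comp P Ps mu n) (J_ P la) = n`!%:R * Pstar_at Ps mu la.
Proof.
move=> e; rewrite /hatP_comp fsbig_finite; last exact: finite_parts.
rewrite formZl form_suml (big_fsetD1 la) /=; last first.
  rewrite in_fset_set; last exact: finite_parts.
  exact/mem_set.
rewrite formZl form_QJ // eqxx mul1r divfK ?c_neq0 // big1_seq ?addr0 // => nu.
rewrite !inE => /andP[_ /andP[ne_nu _]].
by rewrite formZl form_QJ // (negPf ne_nu) mul0r mulr0.
Qed.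

(** Below degree [psize mu] every value of the interpolation polynomial in the sum vanishes, so the
    truncation in [hatP] agrees with the formula. *)
Lemma hatPE n mu : hatP P Ps mu n = hatP_comp P Ps mu n.
Proof.
rewrite /=; case: leqP => // lt_n; rewrite /hatP_comp fsbig_finite; last first.
  exact: finite_parts.
rewrite big1_seq ?scaler0 // => la /andP[_].
rewrite in_fset_set; last exact: finite_parts.
move=> /set_mem /= e; rewrite Pstar_at_eq0 ?e // mul0r scale0r //.
Qed.

Lemma component_sum (T : Type) (r : seq T) (a : T -> K) (F : T -> Compl) n :
  component (\sum_(x <- r) a x *: F x) n = \sum_(x <- r) a x *: component (F x) n.
Proof. by elim: r => [|x r IHr]; rewrite ?big_nil // !big_cons -IHr. Qed.

Lemma form_hat n la F : psize la = n ->
  form (hat P Ps F n) (J_ P la) = n`!%:R * star_at P Ps F la.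
Proof.
move=> e; rewrite /hat /star_at /linext component_sum form_suml mulr_sumr.
by apply: eq_bigr => mu _; rewrite formZl hatPE form_hatP_comp // mulrCA.
Qed.

Lemma qtprod_hat n la F : psize la = n ->
  qtprod P n (hat P Ps F n) (Q_ P la) = star_at P Ps F la *: Q_ P la.
Proof.
move=> e; rewrite (qtprod_Q macP) // form_hat // mulrC mulKf //.
by rewrite natK_neq0 ?fact_gt0.
Qed.

End HatTransform.

Theorem proposition2p1
    (P : intpart -> SymFun) (Ps : intpart -> forall N : nat, {mpoly K[N]})
    (macP : is_macdonald P) (shiftP : is_shifted_macdonald Ps) :
  [/\ forall (mu : intpart) (n : nat) (la : intpart), psize la = n ->
        qtprod P n (hatP_comp P Ps mu n) (Q_ P la) = Pstar_at Ps mu la *: Q_ P la,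
      forall (f : SymFun) (n : nat) (la : intpart), psize la = n ->
        qtprod P n (hat P Ps f n) (Q_ P la) = star_at P Ps f la *: Q_ P la,
      linear (hat P Ps)
    & forall phi : SymFun -> Compl, linear phi ->
        (forall (f : SymFun) (n : nat) (la : intpart), psize la = n ->
           qtprod P n (phi f n) (Q_ P la) = star_at P Ps f la *: Q_ P la) ->
        phi =1 hat P Ps].
Proof.
have fact_neq0 n : n`!%:R != 0 :> K by rewrite natK_neq0 ?fact_gt0.
split=> [mu n la e|f n la e||phi _ phiP f].
- by rewrite (qtprod_Q macP) // form_hatP_comp // mulrC mulKf.
- exact: qtprod_hat.
- exact: linext_linear (P_basis macP) _ _.
apply: val_inj; apply: functional_extensionality_dep => n.
have homC (G : Compl) : component G n \in homdeg n.
  by have /asboolP := componentP G.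
apply/eqP; rewrite -subr_eq0; apply/eqP.
apply: (form_P_eq0 macP (n := n)) => [|la e]; first exact: rpredB.
have := phiP f n la e; rewrite -(qtprod_hat macP shiftP f e) !(qtprod_Q macP) //.
(* As [Q_ P la] is nonzero, its two eigenvalues agree; cancelling n! and [c_ la] leaves equal
   pairings with [P la]. *)
move=> /eqP; rewrite -subr_eq0 -scalerBl scaler_eq0 (negPf (Q_neq0 macP la)) orbF.
rewrite subr_eq0 => /eqP/(mulIf (invr_neq0 (fact_neq0 n))).
rewrite !formZr => /(mulfI (c_neq0 la)) e'.
by rewrite form_sym linearB /= !(form_sym (P la)) e' subrr.
Qed.
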